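(* Let $N\in\mathbb{N}$, write $N=2k$ or $N=2k+1$, let $w_0,\dotsc,w_{N-1}\ge0$ be weights with $W=\operatorname{circ}(w_0,\dotsc,w_{N-1})$ such that the underlying Circulant Laplacian Dynamics (CLD) protocol is gathering, and consider the Nonlinear Scaling of Circulant Laplacian Dynamics (NSCLD) protocol with $n(\|(x,y)\|_2)=\|(x,y)\|_2^{-1}$, i.e. $$\dot z_i=\mathcal{N}\Big(-z_i+\sum_{j=0}^{N-1}w_jz_{i+j}\Big),\qquad \mathcal{N}(x,y)=\frac{1}{\|(x,y)\|_2}\begin{pmatrix}x\\ y\end{pmatrix}\text{ for }(x,y)\neq0,\quad\mathcal{N}(0)=0.$$ Let $\lambda_j=\sum_{i=0}^{N-1}w_i\,e^{2\pi\mathbf{i}\,ij/N}$, and let $V_j^\pm\subseteq\mathbb{R}^{2N}$, $1\le j\le k$, be the subspaces defined in the context. Then the protocol achieves gathering of every initial configuration $0\ne Z_0\in V_j^\pm$ ($j\neq0$) in finite time, and the gathering time is, for any $i\in\{0,\dotsc,N-1\}$, given by $$t_{\mathrm{gather},j}=-\frac{|-1+\lambda_j|}{-1+\Re(\lambda_j)}\,\operatorname{norm}_i(Z_0)=-\frac{|-1+\lambda_j|}{-1+\Re(\lambda_j)}\left\|\begin{pmatrix}a_0\\ b_0\end{pmatrix}\right\|_2>0,$$ where $(a_0,b_0)$ are the coefficients of $Z_0$ with respect to the basis of $V_j^\pm$.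
   Context: $N$ robots with positions $z_i=(x_i,y_i)\in\mathbb{R}^2$, $i=0,\dotsc,N-1$ (indices modulo $N$), are collected in $Z=(X,Y)\in\mathbb{R}^{2N}$, $X=(x_0,\dotsc,x_{N-1})$, $Y=(y_0,\dotsc,y_{N-1})$. For $Z=(X,Y)\in\mathbb{R}^{2N}$, $\operatorname{norm}_i(Z)=\|(x_i,y_i)\|_2$. $\operatorname{circ}(w_0,\dotsc,w_{N-1})$ is the circulant matrix with entries $W_{i,j}=w_{(j-i)\bmod N}$. All weights are non-negative. The underlying CLD protocol is $\dot z_i=-z_i+\sum_{j=0}^{N-1}w_jz_{i+j}$. It is gathering if, for every initial configuration, its solution converges as $t\to\infty$ to a gathering point (there is $z^*\in\mathbb{R}^2$ with $z_i(t)\to z^*$ for all $i$) and every gathering point is an equilibrium ($\dot z_i=0$ for all $i$ whenever $z_0=\dotsb=z_{N-1}$). Let $\omega=\exp(2\pi\mathbf{i}/N)$, $v_j=(1,\omega^j,\dotsc,\omega^{(N-1)j})^T\in\mathbb{C}^N$, with entrywise real and imaginary parts. For $1\le j\le k$ (excluding $j=k$ when $N=2k$): $$V_j^+=\operatorname{span}\left(\begin{pmatrix}\Re(v_j)\\-\Im(v_j)\end{pmatrix},\begin{pmatrix}\Im(v_j)\\ \Re(v_j)\end{pmatrix}\right),\qquad V_j^-=\operatorname{span}\left(\begin{pmatrix}-\Im(v_j)\\ \Re(v_j)\end{pmatrix},\begin{pmatrix}\Re(v_j)\\ \Im(v_j)\end{pmatrix}\right),$$ and $(a_0,b_0)\in\mathbb{R}^2$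 are coefficients with respect to these bases. For $N=2k$ and $j=k$ the vector $v_k$ is real, $V_k^+=\operatorname{span}\begin{pmatrix}v_k\\ 0\end{pmatrix}$, $V_k^-=\operatorname{span}\begin{pmatrix}0\\ v_k\end{pmatrix}$, and $\|(a_0,b_0)\|_2$ is replaced by the absolute value $|a_0|$ of the single coefficient. The right-hand side of the NSCLD system maps each $V_j^\pm$ into itself, and the solution starting at $Z_0\in V_j^\pm$ is the solution of the system restricted to $V_j^\pm$. Gathering in finite time with gathering time $T$ means that the solution $Z(t)$ starting at $Z_0$ is not a gathering point (i.e. not all $z_i$ coincide) for $0\le t<T$ and reaches a gathering point at time $t=T$ (here the origin). *)

(* Defs.v *)
From HB Require Import structures.
From mathcomp Require Import all_boot all_order all_algebra.
From mathcomp Require Import all_classical all_reals all_analysis.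
From mathcomp Require Import complex.

Set Implicit Arguments.
Unset Strict Implicit.
Unset Printing Implicit Defensive.

Import Order.TTheory GRing.Theory Num.Theory.
Import numFieldNormedType.Exports.
Local Open Scope classical_set_scope.
Local Open Scope complex_scope.
Local Open Scope ring_scope.

(* There are N = n.+1 robots.  The indices live in 'I_n.+1, whose ring_scope
   addition is addition modulo N. *)

Section Configurations.
Context {R : realType} {n : nat}.

(* Z = (X, Y) in R^(2N), stored as the column X stacked on the column Y *)
Definition conf : Type := 'cV[R]_(n.+1 + n.+1).

Definition robot (Z : conf) (i : 'I_n.+1) : R * R :=
  (usubmx Z i 0, dsubmx Z i 0).

Definition conf_of (z : 'I_n.+1 -> R * R) : conf :=
  col_mx (\col_i (z i).1) (\col_i (z i).2).

Definition norm2 (p : R * R) : R := Num.sqrt (p.1 ^+ 2 + p.2 ^+ 2).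

Definition norm_robot (i : 'I_n.+1) (Z : conf) : R := norm2 (robot Z i).

Definition gathering_point (Z : conf) : Prop :=
  exists z : R * R, forall i, robot Z i = z.

(* Z is a solution of Z' = F(Z) on [0, +oo[ in the sense of Caratheodory.  The
   right-hand side of the NSCLD system is discontinuous, and its solutions need
   not be differentiable at the time at which they gather.  For a continuous F
   these are exactly the classical C^1 solutions.  The values Z t with t < 0
   are irrelevant. *)
Definition solution (F : conf -> conf) (Z : R -> conf) : Prop :=
  forall (t : R) (m : 'I_(n.+1 + n.+1)), 0 <= t ->
    lebesgue_measure.-integrable `[0, t] (fun s => (F (Z s) m 0)%:E) /\
    Z t m 0 = Z 0 m 0 + \int[lebesgue_measure]_(s in `[0, t]) F (Z s) m 0.

Definition gathering_protocol (F : conf -> conf) : Prop :=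
  (forall Z : R -> conf, solution F Z ->
     exists z : R * R, forall i, robot (Z t) i @[t --> +oo] --> z) /\
  (forall Z : conf, gathering_point Z -> F Z = 0).

(* The solution from Z0 gathers in finite time T, at the configuration P. *)
Definition gathers_at_time (F : conf -> conf) (Z0 : conf) (T : R) (P : conf) :
    Prop :=
  [/\ gathering_point P,
      exists Z, solution F Z /\ Z 0 = Z0 &
      forall Z, solution F Z -> Z 0 = Z0 ->
        (forall t, 0 <= t < T -> ~ gathering_point (Z t)) /\ Z T = P].

End Configurations.

Arguments conf : clear implicits.

Section Protocols.
Context {R : realType} {n : nat}.
Implicit Types (w : 'I_n.+1 -> R) (Z : conf R n).

Definition cld w Z : conf R n :=
  conf_of (fun i =>
    (- (robot Z i).1 + \sum_(j < n.+1) w j * (robot Z (i + j)).1,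
     - (robot Z i).2 + \sum_(j < n.+1) w j * (robot Z (i + j)).2)).

Definition normalize (p : R * R) : R * R :=
  if p == 0 then 0 else (p.1 / norm2 p, p.2 / norm2 p).

Definition nscld w Z : conf R n :=
  conf_of (fun i => normalize (robot (cld w Z) i)).

End Protocols.

Section Spectral.
Context {R : realType}.

Definition expi (x : R) : R[i] := cos x +i* sin x.

Definition omega (N : nat) : R[i] := expi (2 * pi / N%:R).

Definition lambda (n : nat) (w : 'I_n.+1 -> R) (j : nat) : R[i] :=
  \sum_(i < n.+1) (w i)%:C * expi (2 * pi * (i * j)%:R / n.+1%:R).

Definition vec (n j : nat) : 'cV[R[i]]_n.+1 := \col_m omega n.+1 ^+ (m * j).

Definition re_vec (n j : nat) : 'cV[R]_n.+1 := \col_m complex.Re (vec n j m 0).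
Definition im_vec (n j : nat) : 'cV[R]_n.+1 := \col_m complex.Im (vec n j m 0).

(* The Boolean s is the sign: true stands for V_j^+, false for V_j^-. *)

Definition basis1 (n : nat) (s : bool) (j : nat) : conf R n :=
  if s then col_mx (re_vec n j) (- im_vec n j)
  else col_mx (- im_vec n j) (re_vec n j).

Definition basis2 (n : nat) (s : bool) (j : nat) : conf R n :=
  if s then col_mx (im_vec n j) (re_vec n j)
  else col_mx (re_vec n j) (im_vec n j).

(* The spanning vector in the degenerate case N = 2 j, where vec n j is real. *)
Definition basis_half (n : nat) (s : bool) (j : nat) : conf R n :=
  if s then col_mx (re_vec n j) 0 else col_mx 0 (re_vec n j).

Definition Vspace (n : nat) (s : bool) (j : nat) :
    {vspace 'cV[R]_(n.+1 + n.+1)} :=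
  if n.+1 == j.*2 then <[basis_half n s j]>%VS
  else (<[basis1 n s j]> + <[basis2 n s j]>)%VS.

End Spectral.

(* Main.v *)
Require Import Defs.
From mathcomp Require Import all_boot all_order all_algebra.
From mathcomp Require Import all_classical all_reals all_analysis.
From mathcomp Require Import complex.
From mathcomp Require Import ring lra.
Import Order.TTheory GRing.Theory Num.Theory.
Import numFieldNormedType.Exports.
Local Open Scope classical_set_scope.
Local Open Scope ring_scope.
Local Open Scope complex_scope.

(* Writing z_i = x_i + i y_i, the elements of V_j^s are the waves z_i = c u_i with
   c complex and u_i = omega^(-i j) or omega^(i j) according to the sign s.  The
   CLD field multiplies c by mu = -1 + lambda_j or by the conjugate of this, so
   that the NSCLD field turns the system into the planar equation
   c' = mu c / |mu c|, solved by the spiral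
   c(t) = c0 rho e^(i kappa ln rho) with rho = 1 - t/T, kappa = Im mu / Re mu,
   where |c| decreases linearly and vanishes at T.  That Re mu < 0 comes from the
   gathering of the CLD: the weights sum to 1, hence |lambda_j| <= 1, and
   Re lambda_j = 1 would make V_j consist of equilibria.
   No other Caratheodory solution starts at the same point, because
   |p/|p| - q/|q|| <= 2 |p - q| / |q| for all p: along the spiral, before time
   t < T, the field is Lipschitz relative to the spiral itself even though it is
   discontinuous elsewhere, and Gronwall applies. *)

Local Notation nc := Normc.normc.

(** * Unit complex numbers and the modulus on [R[i]] *)

Section Cpx.
Context {R : realType}.
Implicit Types (c z : R[i]) (x y : R).

Lemma expiD x y : expi (x + y) = expi x * expi y.
Proof.
rewrite /expi cosD sinD; apply/eqP; rewrite eq_complex /= eqxx /=.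
by apply/eqP; ring.
Qed.

Lemma expi0 : expi 0 = 1 :> R[i].
Proof. by rewrite /expi cos0 sin0. Qed.

Lemma expi_mulrn x m : expi (x *+ m) = expi x ^+ m.
Proof.
by elim: m => [|m IH]; rewrite ?mulr0n ?expi0 ?expr0 // mulrS exprS expiD IH.
Qed.

Lemma normc_expi x : nc (expi x) = 1.
Proof. by rewrite /Normc.normc /= cos2Dsin2 sqrtr1. Qed.

Lemma normc_conj z : nc z^* = nc z.
Proof. by case: z => a b /=; rewrite sqrrN. Qed.

Lemma normc_real x : nc x%:C = `|x|.
Proof. by rewrite /= expr0n /= addr0 sqrtr_sqr. Qed.

Lemma normc_ge0 z : 0 <= nc z.
Proof. by case: z => a b; exact: sqrtr_ge0. Qed.

Lemma normc_eq0 z : (nc z == 0) = (z == 0).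
Proof.
by apply/eqP/eqP => [/Normc.eq0_normc //|->]; exact: Normc.normc0.
Qed.

Lemma normc_gt0 z : (0 < nc z) = (z != 0).
Proof. by rewrite lt_def normc_ge0 normc_eq0 andbT. Qed.

Lemma normr_Re_le z : `|complex.Re z| <= nc z.
Proof.
by case: z => a b /=; rewrite -sqrtr_sqr ler_wsqrtr// lerDl sqr_ge0.
Qed.

Lemma Re_eq_normc z : complex.Re z = nc z -> complex.Im z = 0.
Proof.
case: z => a b /= ab; apply/eqP; rewrite -sqrf_eq0.
have : a ^+ 2 + b ^+ 2 = a ^+ 2.
  by rewrite {2}ab sqr_sqrtr// addr_ge0// sqr_ge0.
by move=> h; apply/eqP; lra.
Qed.

Lemma omega_unity N : (0 < N)%N -> omega N ^+ N = 1 :> R[i].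
Proof.
move=> N0; rewrite -expi_mulrn -[X in expi X]mulr_natr divfK ?pnatr_eq0 -?lt0n//.
by rewrite mulr_natl /expi cos2pi sin2pi.
Qed.

Lemma expi_neq1 x : 0 < x <= pi -> expi x != 1.
Proof.
move=> /andP[x0 xpi]; apply/eqP => -[c1 _]; move: (x0).
rewrite (_ : x = 0) ?ltxx//; apply: cos_inj; rewrite ?cos0//.
  by rewrite in_itv /= (ltW x0).
by rewrite in_itv /= lexx pi_ge0.
Qed.

Lemma omegaX N m : omega N ^+ m = expi (2 * pi * m%:R / N%:R) :> R[i].
Proof. by rewrite -expi_mulrn -mulr_natr; congr expi; ring. Qed.

End Cpx.

(** * Waves, and the action of both fields on them *)

Section Waves.
Context {R : realType} {n : nat}.
Implicit Types (w : 'I_n.+1 -> R) (Z : conf R n) (c : R[i]) (p q : R * R).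

Lemma robot_conf_of (z : 'I_n.+1 -> R * R) i : robot (conf_of z) i = z i.
Proof. by rewrite /robot /conf_of col_mxKu col_mxKd !mxE; case: (z i). Qed.

Lemma conf_ext Z Z' : (forall i, robot Z i = robot Z' i) -> Z = Z'.
Proof.
move=> ZZ'; rewrite -[Z]vsubmxK -[Z']vsubmxK.
by congr col_mx; apply/colP => i; have [] := ZZ' i.
Qed.

(** With z = x + i y, the vectors spanning V_j^+ are complex multiples of the conjugate of v_j, and
    those of V_j^- are multiples of v_j itself; this is entry m of that vector. *)
Definition phase (s : bool) (j m : nat) : R[i] :=
  if s then (omega n.+1 ^+ (m * j))^* else omega n.+1 ^+ (m * j).

Definition wave s j c : conf R n :=
  conf_of (fun m => (complex.Re (c * phase s j m), complex.Im (c * phase s j m))).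

(** The sum [i + m] wraps modulo N, which is harmless because omega^N = 1. This makes waves
    eigenvectors of every cyclic shift. *)
Lemma phaseD s j (i m : 'I_n.+1) :
  phase s j (i + m)%R = phase s j i * phase s j m.
Proof.
rewrite /phase /= mulnC exprM expr_mod; last first.
  by rewrite exprAC omega_unity// expr1n.
rewrite -exprM mulnDr exprD ![(j * _)%N]mulnC.
by case: s; rewrite ?rmorphM.
Qed.

Lemma normc_phase s j m : nc (phase s j m) = 1.
Proof. by rewrite /phase omegaX; case: s; rewrite ?normc_conj normc_expi. Qed.

Lemma phase0 s j : phase s j 0 = 1.
Proof. by rewrite /phase mul0n expr0; case: s; rewrite ?rmorph1. Qed.

(** The angle 2 pi j / N lies in ]0, pi], because 0 < 2j <= N. *)
Lemma phase1_neq1 s j : (0 < j)%N -> (j.*2 <= n.+1)%N -> phase s j 1 != 1.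
Proof.
move=> j0 jn; rewrite /phase mul1n omegaX.
have e1 : expi (2 * pi * j%:R / n.+1%:R) != 1 :> R[i].
  apply: expi_neq1; apply/andP; split.
    by rewrite divr_gt0 ?ltr0n// !mulr_gt0 ?ltr0n// pi_gt0.
  rewrite ler_pdivrMr ?ltr0n// mulrAC mulrC ler_wpM2l ?pi_ge0//.
  by rewrite -natrM ler_nat mul2n.
case: s => //; apply: contra e1 => /eqP /(congr1 conjc).
by rewrite conjcK rmorph1 => ->.
Qed.

Lemma norm_robot_wave s j c i : norm_robot i (wave s j c) = nc c.
Proof.
rewrite /norm_robot robot_conf_of /norm2 /=.
rewrite -[RHS]mulr1 -(normc_phase s j i) -Normc.normcM.
by case: (c * phase s j i).
Qed.

Lemma wave0 s j : wave s j 0 = 0.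
Proof.
by apply: conf_ext => i; rewrite robot_conf_of mul0r /robot linear0 !mxE.
Qed.

(** Each coordinate is a real-linear functional of c, so that one family of scalar functions serves
    all 2N entries; a y-coordinate is obtained from Im z = Re (- i z). *)
Lemma wave_entry s j (m : 'I_(n.+1 + n.+1)) :
  exists q : R[i], forall c, wave s j c m 0 = complex.Re (c * q).
Proof.
rewrite -[m]splitK /wave /conf_of; case: (fintype.split m) => i /=.
  by exists (phase s j i) => c; rewrite col_mxEu !mxE.
exists (phase s j i * - 'i) => c.
rewrite col_mxEd !mxE mulrA; case: (c * _) => a b /=; ring.
Qed.

(** If robots 0 and 1 coincide, then c ([phase s j 1] - 1) = 0. *)
Lemma wave_not_gathering s j c : (0 < j)%N -> (j.*2 <= n.+1)%N ->
  gathering_point (wave s j c) -> c = 0.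
Proof.
move=> j0 jn [z hz].
have n1 : (1 < n.+1)%N.
  by apply: leq_trans jn; rewrite -addnn (leq_add j0 j0).
have := hz (Ordinal n1); rewrite -(hz ord0) !robot_conf_of /= phase0 mulr1.
move=> [re im].
have /eqP : c * phase s j 1 = c.
  by move: re im; case: (c * _) => a b; case: c {hz} => x y /= -> ->.
rewrite -subr_eq0 -{2}[c]mulr1 -mulrBr mulf_eq0 subr_eq0.
by rewrite (negPf (phase1_neq1 s j j0 jn)) orbF => /eqP.
Qed.

(** The weights are real, so conjugating the eigenvector v_j conjugates its eigenvalue. *)
Definition lambda_s s w j := if s then (lambda w j)^* else lambda w j.

Lemma lambda_sE s w j : lambda_s s w j = \sum_(i < n.+1) (w i)%:C * phase s j i.
Proof.
have -> : lambda_s s w j = let l := \sum_(i < n.+1) (w i)%:C * omega n.+1 ^+ (i * j)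
    in if s then l^* else l.
  by rewrite /lambda_s /lambda; under eq_bigr do rewrite -omegaX.
rewrite /phase /=.
case: s => //; rewrite rmorph_sum; apply: eq_bigr => i _.
by rewrite rmorphM; congr (_ * _); exact: conjc_real.
Qed.

Lemma ReD (x y : R[i]) : complex.Re (x + y) = complex.Re x + complex.Re y.
Proof. by case: x y => [? ?] []. Qed.
Lemma ImD (x y : R[i]) : complex.Im (x + y) = complex.Im x + complex.Im y.
Proof. by case: x y => [? ?] []. Qed.
Lemma Re_realM (a : R) (x : R[i]) : complex.Re (a%:C * x) = a * complex.Re x.
Proof. by case: x => b c /=; rewrite mul0r subr0. Qed.
Lemma Im_realM (a : R) (x : R[i]) : complex.Im (a%:C * x) = a * complex.Im x.
Proof. by case: x => b c /=; rewrite mul0r addr0. Qed.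

Lemma Re_sum (F : 'I_n.+1 -> R[i]) :
  complex.Re (\sum_i F i) = \sum_i complex.Re (F i).
Proof. exact: (big_morph _ ReD). Qed.
Lemma Im_sum (F : 'I_n.+1 -> R[i]) :
  complex.Im (\sum_i F i) = \sum_i complex.Im (F i).
Proof. exact: (big_morph _ ImD). Qed.

(** A cyclic shift by m multiplies the wave by [phase s j m], and the weighted sum of these factors
    is [lambda_s s w j]. *)
Lemma cld_wave w s j c : cld w (wave s j c) = wave s j (c * (-1 + lambda_s s w j)).
Proof.
apply: conf_ext => i; rewrite !robot_conf_of.
under eq_bigr do rewrite robot_conf_of.
under [in X in (_, X)]eq_bigr do rewrite robot_conf_of.
rewrite /=; have -> : c * (- 1 + lambda_s s w j) * phase s j i
   = - (c * phase s j i) + \sum_(m < n.+1) (w m)%:C * (c * phase s j (i + m)%R).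
  rewrite lambda_sE mulrDr mulrDl mulrN1 mulNr; congr (_ + _).
  rewrite mulr_sumr mulr_suml; apply: eq_bigr => m _.
  by rewrite phaseD; ring.
rewrite ReD ImD Re_sum Im_sum; congr pair; congr (_ + _).
- by case: (c * _).
- by apply: eq_bigr => m _; rewrite Re_realM.
- by case: (c * _).
- by apply: eq_bigr => m _; rewrite Im_realM.
Qed.

(** The case z = 0 fits the formula because division by 0 returns 0. *)
Lemma normalizeE (z : R[i]) : normalize (complex.Re z, complex.Im z)
  = (complex.Re (z / (nc z)%:C), complex.Im (z / (nc z)%:C)).
Proof.
have [->|z0] := eqVneq z 0.
  by rewrite mul0r /normalize (_ : (_, _) = 0)// eqxx.
rewrite /normalize ifF; last first.
  apply/negbTE; apply: contra z0 => /eqP.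
  by case: z => a b /= ab; rewrite (congr1 fst ab : a = 0) (congr1 snd ab : b = 0).
rewrite -fmorphV -(mulrC _%:C) Re_realM Im_realM /= ![(nc z)^-1 * _]mulrC.
by case: z {z0}.
Qed.

(** All phases have modulus 1, so the CLD velocities of all robots have the same norm and
    normalization acts on the amplitude alone. *)
Lemma nscld_wave w s j c :
  nscld w (wave s j c) =
  wave s j (c * (-1 + lambda_s s w j) / (nc (c * (-1 + lambda_s s w j)))%:C).
Proof.
rewrite /nscld cld_wave; apply: conf_ext => i; rewrite !robot_conf_of normalizeE.
set z := c * _; rewrite Normc.normcM normc_phase mulr1.
by rewrite mulrAC.
Qed.

Lemma wave_basis s j (a b : R) :
  a *: basis1 n s j + b *: basis2 n s j =
  wave s j (if s then a +i* b else b +i* a).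
Proof.
apply: conf_ext => m; rewrite robot_conf_of /robot /basis1 /basis2 /phase.
case: s; rewrite !scale_col_mx add_col_mx col_mxKu col_mxKd !mxE;
  case: (_ ^+ _) => p q /=; congr pair; ring.
Qed.

Lemma wave_basis_half s j (a : R) : n.+1 = j.*2 ->
  a *: basis_half n s j = wave s j (if s then a%:C else a *i).
Proof.
move=> nj; have pi_j m : complex.Im (omega n.+1 ^+ (m * j) : R[i]) = 0.
  (* For N = 2j, omega^j = e^(i pi) = -1. *)
  have -> : omega n.+1 ^+ (m * j) = (-1) ^+ m :> R[i].
    rewrite mulnC exprM omegaX; congr (_ ^+ _).
    rewrite (_ : _ / _ = pi) /expi ?cospi ?sinpi //.
      by apply/eqP; rewrite eq_complex /= oppr0 !eqxx.
    rewrite nj -mul2n natrM; field.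
    by rewrite pnatr_eq0; case: (j) nj.
  rewrite -signr_odd; case: (odd m) => //=.
  by rewrite oppr0.
apply: conf_ext => m; rewrite robot_conf_of /robot /basis_half /phase.
case: s; rewrite !scale_col_mx col_mxKu col_mxKd !mxE;
  move: (pi_j m); case: (_ ^+ _) => p q /= ->; congr pair; ring.
Qed.

Lemma Vspace_wave s j (Z : conf R n) : Z \in Vspace n s j ->
  exists c, Z = wave s j c.
Proof.
rewrite /Vspace; case: ifP => [/eqP nj /vlineP[a ->]|_].
  by rewrite wave_basis_half//; eexists.
move=> /memv_addP[_ /vlineP[a ->] [_ /vlineP[b ->] ->]].
by rewrite wave_basis; eexists.
Qed.

(** * Spectral consequences of the gathering of the CLD *)

Lemma gathering_sum_weights w : gathering_protocol (cld w) -> \sum_i w i = 1.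
Proof.
(* At this gathering point the first coordinate of the field is -1 plus the sum of the weights, and
   it must vanish. *)
move=> [_ eqF]; pose Z1 : conf R n := conf_of (fun=> (1, 0)).
have : (robot (cld w Z1) 0).1 = (robot (0 : conf R n) 0).1.
  by rewrite eqF//; exists (1, 0) => i; rewrite robot_conf_of.
rewrite /cld !robot_conf_of.
under eq_bigr do rewrite robot_conf_of mulr1.
rewrite /=.
by rewrite /robot linear0 /= mxE addrC => /eqP; rewrite subr_eq0 => /eqP.
Qed.

Lemma normc_sum (F : 'I_n.+1 -> R[i]) : nc (\sum_i F i) <= \sum_i nc (F i).
Proof.
elim/big_ind2 : _ => [|x a y b xa yb|//]; first by rewrite Normc.normc0.
by apply: le_trans (le_normcD _ _) _; exact: lerD.
Qed.

Lemma normc_lambda_s_le s w j : (forall i, 0 <= w i) ->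
  nc (lambda_s s w j) <= \sum_i w i.
Proof.
move=> w0; rewrite lambda_sE; apply: le_trans (normc_sum _) _.
apply: ler_sum => i _.
by rewrite Normc.normcM normc_phase mulr1 normc_real ger0_norm.
Qed.

Lemma gathering_lambda_s s w j : (forall i, 0 <= w i) ->
  gathering_protocol (cld w) -> (0 < j)%N -> (j.*2 <= n.+1)%N ->
  complex.Re (lambda_s s w j) < 1.
Proof.
move=> w0 gw j0 jn; have := normc_lambda_s_le s w j w0.
rewrite (gathering_sum_weights w gw) => l1.
have Rel := ler_norm (complex.Re (lambda_s s w j)).
have Rel' := normr_Re_le (lambda_s s w j).
rewrite ltNge; apply/negP => R1.
have lE : lambda_s s w j = 1.
  have Re1 : complex.Re (lambda_s s w j) = 1 by lra.
  have := Re_eq_normc (lambda_s s w j) ltac:(lra).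
  by move: Re1; case: (lambda_s s w j) => a b /= -> ->.
(* With eigenvalue 1 the constant wave solves the CLD; being its own limit, it would be a gathering
   point. *)
have [+ _] := gw => /(_ (cst (wave s j 1))) [].
  move=> t m t0; rewrite /= cld_wave lE addNr mulr0 wave0 mxE; split.
    exact: integrable0.
  by rewrite Rintegral_cst//= mul0r addr0.
move=> z hz; have : gathering_point (wave s j 1).
  exists z => i.
  apply: (@cvg_unique _ (@norm_hausdorff _ _)
    (robot (wave s j 1) i @[t --> +oo]) _); first exact: cvg_cst.
  exact: hz.
by move=> /(wave_not_gathering s j 1 j0 jn) /eqP; rewrite oner_eq0.
Qed.

(** * Norm estimates for the normalized field *)

Lemma norm2E (p : R * R) : norm2 p = nc (p.1 +i* p.2).
Proof. by []. Qed.

Lemma norm2_ge0 p : 0 <= norm2 p. Proof. exact: sqrtr_ge0. Qed.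

Lemma norm2_eq0 p : (norm2 p == 0) = (p == 0).
Proof.
by rewrite norm2E normc_eq0 eq_complex; case: p.
Qed.

Lemma le_norm2 p : `|p.1| <= norm2 p /\ `|p.2| <= norm2 p.
Proof.
by rewrite /norm2 -!sqrtr_sqr !ler_wsqrtr// ?lerDl ?lerDr sqr_ge0.
Qed.

Lemma norm2_le p : norm2 p <= `|p.1| + `|p.2|.
Proof.
rewrite norm2E (_ : _ +i* _ = p.1%:C + 'i * p.2%:C); last first.
  by apply/eqP; rewrite eq_complex /=; apply/andP; split; apply/eqP; ring.
apply: le_trans (le_normcD _ _) _.
rewrite Normc.normcM !normc_real /= expr0n /= add0r expr1n sqrtr1 mul1r.
by [].
Qed.

Lemma norm2_sub p q : `|norm2 p - norm2 q| <= norm2 (p - q).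
Proof.
have tri (u v : R * R) : norm2 (u + v) <= norm2 u + norm2 v.
  by rewrite !norm2E; exact: (le_normcD (u.1 +i* u.2) (v.1 +i* v.2)).
have nN (u : R * R) : norm2 (- u) = norm2 u by rewrite /norm2 /= !sqrrN.
have := tri (p - q) q; have := tri (q - p) p; rewrite !subrK.
by rewrite -(nN (q - p)) opprB ler_norml; move=> ? ?; apply/andP; split; lra.
Qed.

Lemma norm2_normalize_le p : norm2 (normalize p) <= 1.
Proof.
rewrite /normalize; case: ifPn => [_|p0].
  by rewrite /norm2 /= expr0n addr0 sqrtr0.
rewrite /norm2 /= !expr_div_n -mulrDl sqrtrM ?addr_ge0 ?sqr_ge0//.
rewrite -/(norm2 p) -exprVn sqrtr_sqr normfV (ger0_norm (norm2_ge0 p)).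
by rewrite divff// norm2_eq0.
Qed.

(* The bound only involves the norm of [q], and also holds where [normalize] is
   discontinuous in [p]. *)
Lemma normalize_lipschitz p q : q != 0 ->
  `|(normalize p).1 - (normalize q).1| <= 2 * norm2 (p - q) / norm2 q /\
  `|(normalize p).2 - (normalize q).2| <= 2 * norm2 (p - q) / norm2 q.
Proof.
move=> q0; have nq0 : 0 < norm2 q by rewrite lt_def norm2_eq0 q0 norm2_ge0.
have [->|p0] := eqVneq p 0.
  have [] := le_norm2 (normalize q); have := norm2_normalize_le q.
  rewrite sub0r (_ : norm2 (- q) = norm2 q) ?mulfK ?gt_eqF//; last first.
    by rewrite /norm2 /= !sqrrN.
  have -> : normalize (0 : R * R) = 0 by rewrite /normalize eqxx.
  by rewrite /= !sub0r !normrN => ? ? ?; split; lra.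
have np0 : 0 < norm2 p by rewrite lt_def norm2_eq0 p0 norm2_ge0.
rewrite /normalize (negPf p0) (negPf q0) /=.
have key x y : `|x| <= norm2 p -> `|x - y| <= norm2 (p - q) ->
    `|x / norm2 p - y / norm2 q| <= 2 * norm2 (p - q) / norm2 q.
  move=> xp xy.
  (* Both terms of this numerator are at most |p - q|, the first by the reverse triangle inequality;
     hence the factor 2. *)
  have -> : x / norm2 p - y / norm2 q =
      (x / norm2 p * (norm2 q - norm2 p) + (x - y)) / norm2 q.
    by field; rewrite !gt_eqF.
  rewrite normrM normfV (gtr0_norm nq0) ler_wpM2r ?invr_ge0 ?(ltW nq0)//.
  apply: le_trans (ler_normD _ _) _; rewrite mulr_natl mulr2n lerD//.
  rewrite normrM normrM normfV (gtr0_norm np0) distrC.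
  rewrite -[leRHS]mul1r ler_pM ?normr_ge0 ?divr_ge0 ?(ltW np0) ?norm2_sub//.
  by rewrite ler_pdivrMr// mul1r.
have [p1 p2] := le_norm2 p; have [d1 d2] := le_norm2 (p - q).
by split; apply: key.
Qed.

Lemma nscld_le1 w Z (m : 'I_(n.+1 + n.+1)) : `|nscld w Z m 0| <= 1.
Proof.
rewrite -[m]splitK /nscld /conf_of; case: (fintype.split m) => i /=;
  rewrite ?col_mxEu ?col_mxEd !mxE;
  apply: le_trans (norm2_normalize_le (robot (cld w Z) i));
  by have [] := le_norm2 (normalize (robot (cld w Z) i)).
Qed.

(** In each coordinate the own position contributes B and the weighted average another B, as the
    weights sum to 1; the two coordinates together give 4 B. *)
Lemma cld_dist w Z Z' B i : (forall i, 0 <= w i) -> \sum_i w i = 1 ->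
  (forall m, `|Z m 0 - Z' m 0| <= B) ->
  norm2 (robot (cld w Z) i - robot (cld w Z') i) <= 4 * B.
Proof.
move=> w0 w1 ZB.
have key (x y : 'I_n.+1 -> R) : (forall i, `|x i - y i| <= B) ->
    `|(- x i + \sum_(j < n.+1) w j * x (i + j)) -
      (- y i + \sum_(j < n.+1) w j * y (i + j))| <= 2 * B.
  move=> xy.
  have -> : (- x i + \sum_(j < n.+1) w j * x (i + j)) -
      (- y i + \sum_(j < n.+1) w j * y (i + j)) =
      - (x i - y i) + \sum_(j < n.+1) w j * (x (i + j) - y (i + j)).
    under [X in _ = _ + X]eq_bigr do rewrite mulrBr.
    by rewrite big_split /= sumrN; ring.
  apply: le_trans (ler_normD _ _) _; rewrite normrN mulr_natl mulr2n lerD//.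
  apply: le_trans (ler_norm_sum _ _ _) _.
  rewrite -[leRHS]mul1r -w1 mulr_suml; apply: ler_sum => j _.
  by rewrite normrM ger0_norm// ler_wpM2l.
apply: le_trans (norm2_le _) _.
have -> : 4 * B = 2 * B + 2 * B by ring.
rewrite /cld !robot_conf_of; apply: lerD;
  [apply: (key (fun i => (robot Z i).1) (fun i => (robot Z' i).1)) => l
  |apply: (key (fun i => (robot Z i).2) (fun i => (robot Z' i).2)) => l];
  rewrite /robot /= !mxE; exact: ZB.
Qed.

(** The constant 8 is 2 from [normalize_lipschitz] times 4 from [cld_dist]. The comparison is of an
    arbitrary [Z] with a wave, whose CLD velocity has the same norm at every robot. *)
Lemma nscld_lipschitz w s j c Z B m : (forall i, 0 <= w i) -> \sum_i w i = 1 ->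
  c * (-1 + lambda_s s w j) != 0 ->
  (forall m, `|Z m 0 - wave s j c m 0| <= B) ->
  `|nscld w Z m 0 - nscld w (wave s j c) m 0| <=
    8 / nc (c * (-1 + lambda_s s w j)) * B.
Proof.
move=> w0 w1 c0 ZB; pose Z' := wave s j c.
suff key i : `|(normalize (robot (cld w Z) i)).1 - (normalize (robot (cld w Z') i)).1|
      <= 8 / nc (c * (-1 + lambda_s s w j)) * B /\
    `|(normalize (robot (cld w Z) i)).2 - (normalize (robot (cld w Z') i)).2|
      <= 8 / nc (c * (-1 + lambda_s s w j)) * B.
  rewrite -[m]splitK /nscld /conf_of.
  case: (fintype.split m) => i /=; have [] := key i;
    by rewrite ?col_mxEu ?col_mxEd !mxE.
have nq : norm2 (robot (cld w Z') i) = nc (c * (-1 + lambda_s s w j)).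
  by rewrite /Z' cld_wave -/(norm_robot _ _) norm_robot_wave.
have q0 : robot (cld w Z') i != 0 by rewrite -norm2_eq0 nq normc_eq0.
have [d1 d2] := normalize_lipschitz (robot (cld w Z) i) _ q0.
suff le8 : 2 * norm2 (robot (cld w Z) i - robot (cld w Z') i) /
    norm2 (robot (cld w Z') i) <= 8 / nc (c * (-1 + lambda_s s w j)) * B.
  by split; [exact: le_trans d1 le8|exact: le_trans d2 le8].
rewrite nq [leRHS]mulrAC ler_wpM2r ?invr_ge0 ?normc_ge0//.
by have := cld_dist w Z Z' B i w0 w1 ZB; lra.
Qed.

End Waves.

(** * Vanishing criteria and bounds on integrals *)

Section Integrals.
Context {R : realType}.
Implicit Types (f g : R -> R) (a t C K x : R).
Local Notation mu := (@lebesgue_measure R).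

(** Used to reach the time T, where stopping at T (1 - e) leaves an error proportional to e. *)
Lemma normr_le_small x K :
  (forall e, 0 < e <= 1 -> `|x| <= K * e) -> x = 0.
Proof.
move=> h; apply/eqP; rewrite -normr_eq0 eq_le normr_ge0 andbT leNgt.
apply/negP => x0; have K0 : 0 < K by have := h 1; rewrite ltr01 lexx; lra.
have : 0 < Num.min 1 (`|x| / (2 * K)) <= 1.
  by rewrite lt_min ltr01 ge_min lexx /= andbT divr_gt0// mulr_gt0.
move=> /h; apply/negP; rewrite -ltNge.
apply: (@le_lt_trans _ _ (K * (`|x| / (2 * K)))).
  by rewrite ler_wpM2l ?(ltW K0)// ge_min lexx orbT.
have -> : K * (`|x| / (2 * K)) = `|x| / 2 by field; rewrite gt_eqF.
lra.
Qed.

Lemma normr_le_geometric x K : (forall k, `|x| <= K / 2 ^+ k) -> x = 0.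
Proof.
move=> h; apply/eqP; rewrite -normr_eq0 eq_le normr_ge0 andbT leNgt.
apply/negP => x0; have K0 : 0 <= K.
  by apply: le_trans (ltW x0) _; have := h 0%N; rewrite expr0 divr1.
have := archi_boundP (divr_ge0 K0 (ltW x0)); set k := Num.bound _ => Kk.
have := h k; apply/negP; rewrite -ltNge ltr_pdivrMr ?exprn_gt0//.
rewrite mulrC -ltr_pdivrMr//; apply: lt_le_trans Kk _.
by rewrite -natrX ler_nat ltnW// ltn_expl.
Qed.

Lemma bounded_integrable_itv f (b1 b2 : bool) a t C :
  measurable_fun [set` Interval (BSide b1 a) (BSide b2 t)] f ->
  (forall r, `|f r| <= C) ->
  mu.-integrable [set` Interval (BSide b1 a) (BSide b2 t)] (EFin \o f).
Proof.
move=> mf fC; apply: measurable_bounded_integrable => //.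
  by rewrite [ltLHS]lebesgue_measure_itv; case: ifP => _; rewrite ?ltry.
exists C; split; first exact: num_real.
by move=> y Cy r _; apply: le_trans (fC r) (ltW Cy).
Qed.

Lemma integral_increment_le f a t C : 0 <= a -> a <= t ->
  mu.-integrable `[0, t] (EFin \o f) ->
  (forall r, a <= r <= t -> `|f r| <= C) ->
  `|\int[mu]_(r in `[0, t]) f r - \int[mu]_(r in `[0, a]) f r| <= C * (t - a).
Proof.
move=> a0 at' fi fC; rewrite Rintegral_itvB// ?bnd_simp//.
have fi' : mu.-integrable `]a, t] (EFin \o f).
  apply: integrableS fi => //; apply: subset_itvr; by rewrite bnd_simp.
apply: le_trans (le_normr_Rintegral _ fi') _ => //.
have := @Rintegral_cst _ _ R mu `]a, t]%classic (measurable_itv _) C.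
rewrite /= lebesgue_measure_itv /= lte_fin.
have [lat|] := ltP a t; last first.
  move=> ta _; have -> : a = t by apply/eqP; rewrite eq_le at' ta.
  by rewrite set_itvoc0 Rintegral_set0 subrr mulr0.
rewrite /= => <-; apply: le_Rintegral => //.
- exact: integrable_norm.
- by apply: (@bounded_integrable_itv (cst C) _ _ _ _ `|C|).
by move=> r /=; rewrite in_itv /= => /andP[ar rt]; apply: fC; rewrite (ltW ar).
Qed.

End Integrals.

(** * Uniqueness by comparison with a reference solution *)

Section Uniqueness.
Context {R : realType} {n : nat}.
Variables (F : conf R n -> conf R n) (M : R).
Hypothesis F_le : forall Z m, `|F Z m 0| <= M.
Local Notation mu := (@lebesgue_measure R).

Lemma solution_dist_increment Z Z' (a t C : R) m : solution F Z -> solution F Z' ->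
  0 <= a -> a <= t ->
  (forall r, a <= r <= t -> `|F (Z r) m 0 - F (Z' r) m 0| <= C) ->
  `|(Z t m 0 - Z' t m 0) - (Z a m 0 - Z' a m 0)| <= C * (t - a).
Proof.
move=> sZ sZ' a0 at' FC; have t0 := le_trans a0 at'.
have [i1 e1] := sZ t m t0; have [i2 e2] := sZ' t m t0.
have [i3 e3] := sZ a m a0; have [i4 e4] := sZ' a m a0.
rewrite e1 e2 e3 e4.
have it : mu.-integrable `[0, t] (EFin \o (fun r => F (Z r) m 0 - F (Z' r) m 0)).
  by apply: eq_integrable (integrableB _ i1 i2) => //.
have := integral_increment_le _ _ _ _ a0 at' it FC.
rewrite !RintegralB//; congr (`|_| <= _); ring.
Qed.

(** Picard iteration: |F| <= M gives the initial distance bound 2 M (t - a), and each pass through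
    the integral equation multiplies the bound by L (t - a) <= 1/2. The Lipschitz condition is
    relative to [Z'] only, so F may be discontinuous elsewhere. *)
Lemma solution_unique_step (L : R) Z Z' (a t : R) : solution F Z -> solution F Z' ->
  0 <= L -> 0 <= a -> a <= t -> L * (t - a) <= 1 / 2 -> Z a = Z' a ->
  (forall r (Y : conf R n) (B : R), a <= r <= t -> (forall m, `|Y m 0 - Z' r m 0| <= B) ->
    forall m, `|F Y m 0 - F (Z' r) m 0| <= L * B) ->
  Z t = Z' t.
Proof.
move=> sZ sZ' L0 a0 at' Lta Za lip.
have M0 : 0 <= M by apply: le_trans (F_le (Z a) 0).
have dist k r m : a <= r <= t -> `|Z r m 0 - Z' r m 0| <= 2 * M * (t - a) / 2 ^+ k.
  elim: k r m => [|k IH] r m /andP[ar rt].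
    have := solution_dist_increment Z Z' a r (2 * M) m sZ sZ' a0 ar.
    rewrite Za subrr subr0 expr0 divr1 => h; apply: le_trans (h _) _.
      move=> u _; apply: le_trans (ler_normB _ _) _.
      by rewrite mulr_natl mulr2n lerD.
    by rewrite ler_wpM2l ?mulr_ge0// lerB.
  have := solution_dist_increment Z Z' a r (L * (2 * M * (t - a) / 2 ^+ k)) m
    sZ sZ' a0 ar.
  rewrite Za subrr subr0 => h; apply: le_trans (h _) _.
    move=> u /andP[au ur]; apply: lip; first by rewrite au (le_trans ur).
    by move=> l; apply: IH; rewrite au (le_trans ur).
  rewrite exprS invfM [leRHS]mulrCA mulrAC ler_wpM2r//.
    by rewrite divr_ge0 ?exprn_ge0// !mulr_ge0// subr_ge0.
  apply: le_trans (_ : L * (t - a) <= _); last by rewrite -div1r.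
  by rewrite ler_wpM2l// lerB.
apply/matrixP => m l; rewrite ord1; apply/eqP; rewrite -subr_eq0; apply/eqP.
by apply: normr_le_geometric => k; apply: dist; rewrite at' lexx.
Qed.

Lemma solution_unique (L : R) Z Z' (T : R) : solution F Z -> solution F Z' ->
  0 < L -> Z 0 = Z' 0 ->
  (forall r (Y : conf R n) (B : R), 0 <= r <= T -> (forall m, `|Y m 0 - Z' r m 0| <= B) ->
    forall m, `|F Y m 0 - F (Z' r) m 0| <= L * B) ->
  forall t, 0 <= t <= T -> Z t = Z' t.
Proof.
move=> sZ sZ' L0 Z0 lip t /andP[t0 tT].
(* p bounds the number of steps of length 1 / (2 L) that cover [0, t]; the first one is cut off at
   0. *)
have [p] : exists p : nat, 2 * L * t <= p%:R.
  exists (Num.bound (2 * L * t)); apply/ltW/archi_boundP.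
  by rewrite !mulr_ge0// ltW.
elim: p t t0 tT => [|p IH] t t0 tT tp.
  have -> // : t = 0; apply/eqP; rewrite eq_le t0 andbT.
  by move: tp; rewrite pmulr_rle0// mulr_gt0.
have a0 : 0 <= Num.max 0 (t - 1 / (2 * L)) by rewrite le_max lexx.
have at' : Num.max 0 (t - 1 / (2 * L)) <= t.
  by rewrite ge_max t0 lerBlDr lerDl divr_ge0// mulr_ge0// ltW.
apply: (solution_unique_step L Z Z' (Num.max 0 (t - 1 / (2 * L)))) => //.
- exact: ltW.
- have -> : 1 / 2 = L * (t - (t - 1 / (2 * L))) by field; rewrite gt_eqF.
  by rewrite ler_wpM2l ?(ltW L0)// lerB// le_max lexx orbT.
- have [ta|ta] := leP 0 (t - 1 / (2 * L)); last by rewrite Z0.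
  apply: IH => //; first by apply: le_trans tT; rewrite (max_r ta) in at'.
  have -> : 2 * L * (t - 1 / (2 * L)) = 2 * L * t - 1 by field; rewrite gt_eqF.
  by rewrite lerBlDr natr1.
by move=> r Y B /andP[ar rt]; apply: lip; rewrite (le_trans a0)//= (le_trans rt).
Qed.

End Uniqueness.

(** * The coordinate functions of the spiral *)

Section Spiral.
Context {R : realType}.
Variables (T kappa A B : R).
Hypothesis T_gt0 : 0 < T.
Local Notation mu := (@lebesgue_measure R).
Let angle t : R := kappa * ln (1 - t / T).

(** The real part of (A + i B) rho^(1 + i kappa) with rho = 1 - t/T. *)
Definition spiral t : R :=
  (1 - t / T) * (A * cos (angle t) - B * sin (angle t)).
(** The real part of -(1/T) (A + i B) (1 + i kappa) rho^(i kappa), which stays bounded as t tends to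
    T. *)
Definition spiral' t : R :=
  - T^-1 * ((A - kappa * B) * cos (angle t) - (B + kappa * A) * sin (angle t)).

Let radius_gt0 t : t < T -> 0 < 1 - t / T.
Proof. by move=> tT; rewrite subr_gt0 ltr_pdivrMr// mul1r. Qed.

Let is_derive_angle t : t < T ->
  is_derive t 1 angle (- (kappa / (T * (1 - t / T)))).
Proof.
move=> tT; have r0 := radius_gt0 t tT.
have dr : is_derive t 1 (fun t => 1 - t / T) (- T^-1).
  apply: is_derive_eq; rewrite /GRing.scale/=; ring.
have dl : is_derive t 1 (fun t => ln (1 - t / T)) ((1 - t / T)^-1 * - T^-1).
  exact: (@is_derive1_comp _ (@ln R) (fun t => 1 - t / T) t _ _ (is_derive1_ln r0) dr).
apply: is_derive_eq; rewrite /GRing.scale/=.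
by field; rewrite subr_eq0 !gt_eqF.
Qed.

Lemma is_derive_spiral t : t < T -> is_derive t 1 spiral (spiral' t).
Proof.
move=> tT; have da := is_derive_angle t tT; have r0 := radius_gt0 t tT.
have dr : is_derive t 1 (fun t => 1 - t / T) (- T^-1).
  apply: is_derive_eq; rewrite /GRing.scale/=; ring.
have dc : is_derive t 1 (fun t => cos (angle t))
    (- sin (angle t) * - (kappa / (T * (1 - t / T)))).
  exact: (@is_derive1_comp _ (@cos R) angle t _ _ (is_derive_cos (angle t)) da).
have ds : is_derive t 1 (fun t => sin (angle t))
    (cos (angle t) * - (kappa / (T * (1 - t / T)))).
  exact: (@is_derive1_comp _ (@sin R) angle t _ _ (is_derive_sin (angle t)) da).
have dd : is_derive t 1 (fun t => A * cos (angle t) - B * sin (angle t))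
   (A * (- sin (angle t) * - (kappa / (T * (1 - t / T)))) -
    B * (cos (angle t) * - (kappa / (T * (1 - t / T))))).
  apply: is_deriveB.
apply: is_derive_eq; rewrite /GRing.scale/= /spiral'.
by field; rewrite subr_eq0 !gt_eqF.
Qed.

Lemma continuous_spiral' t : t < T -> {for t, continuous spiral'}.
Proof.
move=> tT.
have ca : {for t, continuous angle}.
  have [d _] := is_derive_angle t tT.
  by apply: differentiable_continuous; apply/derivable1_diffP.
have cc : {for t, continuous (fun t => cos (angle t))}.
  by apply: continuous_comp => //; exact: continuous_cos.
have cs : {for t, continuous (fun t => sin (angle t))}.
  by apply: continuous_comp => //; exact: continuous_sin.
by apply: cvgM; [exact: cvg_cst|apply: cvgB; apply: cvgM => //; exact: cvg_cst].
Qed.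

Let lin_trig_le (x y u : R) : `|x * cos u - y * sin u| <= `|x| + `|y|.
Proof.
apply: le_trans (ler_normB _ _) _; rewrite !normrM; apply: lerD.
  by rewrite ler_piMr// ler_norml cos_geN1 cos_le1.
by rewrite ler_piMr// ler_norml sin_geN1 sin_le1.
Qed.

Lemma integral_spiral t : 0 <= t ->
  mu.-integrable `[0, t] (EFin \o (fun s => if s < T then spiral' s else 0)) /\
  (if t < T then spiral t else 0) =
    A + \int[mu]_(s in `[0, t]) (if s < T then spiral' s else 0).
Proof.
pose g s := if s < T then spiral' s else 0.
pose C := T^-1 * (`|A - kappa * B| + `|B + kappa * A|).
have C0 : 0 <= C by rewrite mulr_ge0 ?invr_ge0 ?addr_ge0// ltW.
have gC s : `|g s| <= C.
  rewrite /g; case: ifP => _; last by rewrite normr0.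
  by rewrite /C normrM normrN [`|T^-1|]gtr0_norm ?invr_gt0//
    ler_wpM2l ?invr_ge0 ?(ltW T_gt0).
have mg : measurable_fun setT g.
  (* The cut-off may be discontinuous at T, so measurability comes from continuity on the open
     half-line below T. *)
  have -> : g = spiral' \_ `]-oo, T[.
    by apply/funext => s; rewrite patchE /g mem_setE in_itv.
  apply/(measurable_restrictT _ _).1 => //.
  apply: measurable_realfun.open_continuous_measurable_fun => // s.
  by rewrite inE /= in_itv /= => sT; apply: continuous_spiral'.
have ig u : mu.-integrable `[0, u] (EFin \o g).
  by apply: (bounded_integrable_itv _ _ _ _ _ C) => //; exact: measurable_funTS.
have spiral0 : spiral 0 = A.
  by rewrite /spiral /angle mul0r subr0 ln1 mulr0 cos0 sin0 mul1r mulr0 mulr1 subr0.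
have before u : 0 <= u < T -> spiral u = A + \int[mu]_(s in `[0, u]) g s.
  move=> /andP[]; rewrite le_eqVlt => /predU1P[<- _|u0 uT].
    by rewrite set_itv1 Rintegral_set1 addr0 spiral0.
  have lt_T s : s <= u -> s < T by move=> su; exact: le_lt_trans su uT.
  have -> : \int[mu]_(s in `[0, u]) g s = \int[mu]_(s in `[0, u]) spiral' s.
    apply: eq_Rintegral => s; rewrite inE /= in_itv /= => /andP[_ su].
    by rewrite /g lt_T.
  have cspiral s : s <= u -> {for s, continuous spiral}.
    move=> /lt_T /is_derive_spiral [d _].
    by apply: differentiable_continuous; apply/derivable1_diffP.
  rewrite /Rintegral (@continuous_FTC2 _ spiral' spiral)//.
  - by rewrite /= spiral0; ring.
  - apply: continuous_in_subspaceT => s; rewrite inE /= in_itv /= => /andP[_ su].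
    exact/continuous_spiral'/lt_T.
  - split.
    + move=> s; rewrite in_itv /= => /andP[_ /ltW/lt_T su].
      by have [] := is_derive_spiral s su.
    + by apply: cvg_at_right_filter; apply: cspiral; exact: ltW.
    + by apply: cvg_at_left_filter; apply: cspiral.
  - move=> s; rewrite in_itv /= => /andP[_ /ltW/lt_T su].
    by rewrite derive1E; have [_ ->] := is_derive_spiral s su.
have atT : A + \int[mu]_(s in `[0, T]) g s = 0.
  (* At u = T (1 - e) the radius is e, so the spiral is at most e (|A| + |B|) there, and the
     integral from u to T adds at most C (T - u) = C T e. *)
  apply: (normr_le_small _ (`|A| + `|B| + C * T)) => e /andP[e0 e1].
  pose u := T * (1 - e).
  have u0 : 0 <= u by rewrite mulr_ge0 ?subr_ge0// ltW.
  have uT : u < T by rewrite /u mulrBr mulr1 gtrBl mulr_gt0.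
  have := integral_increment_le g u T C u0 (ltW uT) (ig T) (fun r _ => gC r).
  have := before u; rewrite u0 uT => /(_ isT) bu.
  have -> : A + \int[mu]_(s in `[0, T]) g s =
    spiral u + (\int[mu]_(s in `[0, T]) g s - \int[mu]_(s in `[0, u]) g s).
    by rewrite bu; ring.
  move=> inc; apply: le_trans (ler_normD _ _) _.
  have -> : (`|A| + `|B| + C * T) * e = e * (`|A| + `|B|) + C * (T - u).
    by rewrite /u; ring.
  rewrite lerD// /spiral.
  have -> : 1 - u / T = e by rewrite /u; field; rewrite gt_eqF.
  by rewrite normrM gtr0_norm// ler_wpM2l ?(ltW e0).
move=> t0; split; first exact: ig.
case: ltP => tT; first by apply: before; rewrite t0.
(* Past T the integrand is 0, so the integral keeps its value at T. *)
apply: etrans (esym atT) _; congr (_ + _); apply/esym/eqP.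
rewrite -subr_eq0; apply/eqP.
have z0 r : T <= r <= t -> `|g r| <= 0.
  by move=> /andP[Tr _]; rewrite /g ltNge Tr /= normr0.
have := integral_increment_le g T t 0 (ltW T_gt0) tT (ig t) z0.
by rewrite mul0r normr_le0 => /eqP.
Qed.

End Spiral.

(** * The explicit solution in V_j and its uniqueness *)

Section WaveSolution.
Context {R : realType} {n : nat}.
Variables (w : 'I_n.+1 -> R) (s : bool) (j : nat) (c0 : R[i]).
Hypothesis w_ge0 : forall i, 0 <= w i.
Hypothesis sum_w : \sum_i w i = 1.
Let mu : R[i] := -1 + lambda_s s w j.
Hypothesis Re_mu_lt0 : complex.Re mu < 0.
Hypothesis c0_neq0 : c0 != 0.

(** Along c' = mu c / |mu c| the modulus of c has constant derivative Re mu / |mu|; this is the time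
    at which it falls from |c0| to 0. *)
Definition gather_time : R := - (nc mu / complex.Re mu) * nc c0.
Let T := gather_time.
Let kappa : R := complex.Im mu / complex.Re mu.

Definition amplitude (t : R) : R[i] :=
  if t < T then c0 * (1 - t / T)%:C * expi (kappa * ln (1 - t / T)) else 0.

Let mu_neq0 : mu != 0.
Proof. by apply/eqP => mu0; move: Re_mu_lt0; rewrite mu0 ltxx. Qed.

Lemma gather_time_gt0 : 0 < gather_time.
Proof.
by rewrite /gather_time -mulrN -invrN !mulr_gt0 ?invr_gt0 ?oppr_gt0 ?normc_gt0.
Qed.

Let radius_gt0 (t : R) : t < T -> 0 < 1 - t / T.
Proof. by move=> tT; rewrite subr_gt0 ltr_pdivrMr ?gather_time_gt0// mul1r. Qed.

Lemma normc_amplitude (t : R) : t < T -> nc (amplitude t) = nc c0 * (1 - t / T).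
Proof.
move=> tT; rewrite /amplitude tT !Normc.normcM normc_expi mulr1 normc_real.
by rewrite gtr0_norm ?radius_gt0.
Qed.

Lemma amplitude_neq0 (t : R) : t < T -> amplitude t != 0.
Proof.
move=> tT; rewrite -normc_gt0 normc_amplitude// mulr_gt0 ?radius_gt0//.
by rewrite normc_gt0.
Qed.

Lemma amplitude0 : amplitude 0 = c0.
Proof.
by rewrite /amplitude gather_time_gt0 mul0r subr0 ln1 mulr0 expi0 !mulr1.
Qed.

Lemma solution_wave : solution (nscld w) (fun t => wave s j (amplitude t)).
Proof.
move=> t m t0; have [q waveE] := @wave_entry R n s j m.
have T0 := gather_time_gt0.
pose A := complex.Re (c0 * q); pose B := complex.Im (c0 * q).
have ampE r : complex.Re (amplitude r * q) =
    if r < T then spiral T kappa A B r else 0.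
  rewrite /amplitude; case: ifP => _; last by rewrite mul0r.
  rewrite mulrAC (mulrAC c0) /spiral /A /B.
  by case: (c0 * q) => a b; rewrite /expi /=; ring.
have fieldE r : nscld w (wave s j (amplitude r)) m 0 =
    if r < T then spiral' T kappa A B r else 0.
  rewrite nscld_wave waveE -/mu; case: (ltP r T) => rT; last first.
    by rewrite /amplitude ltNge rT /= !mul0r.
  have r0 := radius_gt0 r rT; rewrite Normc.normcM normc_amplitude//.
  rewrite /amplitude rT /spiral' -fmorphV.
  set rho := 1 - r / T in r0 *; set phi := kappa * _.
  have -> : c0 * rho%:C * expi phi * mu * ((nc c0 * rho * nc mu)^-1)%:C * q =
      (rho * (nc c0 * rho * nc mu)^-1)%:C * (c0 * q * (expi phi * mu)).
    by rewrite rmorphM; ring.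
  rewrite Re_realM /A /B {1}/T /gather_time.
  have Remu := Re_mu_lt0; rewrite /kappa.
  have c00 : nc c0 != 0 by rewrite normc_eq0.
  have nmu : nc mu != 0 by rewrite normc_eq0.
  move: Remu nmu; move: (nc mu) (nc c0) c00 => N r1 r10.
  case: (c0 * q) (mu) => a b [u v] /= u0 N0.
  (* The identity amounts to mu / (|mu| |c0|) = -(1 + i kappa) / T. *)
  by field; rewrite r10 N0 (gt_eqF r0) (lt_eqF u0).
have [it eqt] := integral_spiral T kappa A B T0 t t0; split.
  by apply: eq_integrable it => // r _ /=; rewrite fieldE.
rewrite !waveE ampE eqt amplitude0; congr (_ + _).
by apply: eq_Rintegral => r _; rewrite -fieldE.
Qed.

Lemma amplitude_unique Z : solution (nscld w) Z -> Z 0 = wave s j c0 ->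
  forall t, 0 <= t < T -> Z t = wave s j (amplitude t).
Proof.
move=> sZ Z0 t /andP[t0 tT]; have T0 := gather_time_gt0.
have nt : 0 < nc (amplitude t * mu) by rewrite normc_gt0 mulf_neq0// amplitude_neq0.
(* The amplitude shrinks with time, so the Lipschitz constant at the end time t < T dominates all
   the earlier ones. *)
apply: (solution_unique (nscld w) 1 (nscld_le1 w) (8 / nc (amplitude t * mu)) _ _ t
  sZ solution_wave) => //.
- by rewrite divr_gt0.
- by rewrite amplitude0.
- move=> r Y B /andP[r0 rt] YB m; have rT := le_lt_trans rt tT.
  have B0 : 0 <= B by apply: le_trans (YB m).
  have nr : amplitude r * mu != 0 by rewrite mulf_neq0// amplitude_neq0.
  apply: le_trans (nscld_lipschitz w s j _ Y B m w_ge0 sum_w nr YB) _.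
  rewrite ler_wpM2r// ler_wpM2l// lef_pV2 ?posrE ?normc_gt0//; last first.
    by rewrite -normc_gt0.
  rewrite !Normc.normcM !normc_amplitude// ler_wpM2r ?normc_ge0//.
  by rewrite ler_wpM2l ?normc_ge0// lerB// ler_wpM2r// invr_ge0 ltW.
by rewrite t0 lexx.
Qed.

Lemma gathers_wave : (0 < j)%N -> (j.*2 <= n.+1)%N ->
  gathers_at_time (nscld w) (wave s j c0) T 0.
Proof.
move=> j0 jn; have T0 := gather_time_gt0; split.
- by exists (0, 0) => i; rewrite /robot !linear0 !mxE.
- exists (fun t => wave s j (amplitude t)); split; first exact: solution_wave.
  by rewrite amplitude0.
move=> Z sZ Z0; have uniq := amplitude_unique Z sZ Z0; split=> [t t0T|].
  rewrite uniq// => /(wave_not_gathering s j _ j0 jn) /eqP.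
  by apply/negP/amplitude_neq0; case/andP: t0T.
apply/matrixP => m l; rewrite ord1 mxE.
(* The Lipschitz constant blows up at T. Instead, the two solutions agree at u = T (1 - e), and each
   field entry is at most 1 in absolute value, so at T they differ by at most 2 (T - u) = 2 T e. *)
apply: (normr_le_small _ (2 * T)) => e /andP[e0 e1].
pose u := T * (1 - e).
have u0 : 0 <= u by rewrite mulr_ge0 ?subr_ge0// ltW.
have uT : u < T by rewrite /u mulrBr mulr1 gtrBl mulr_gt0.
have := solution_dist_increment _ Z _ u T 2 m sZ solution_wave u0 (ltW uT).
rewrite (uniq u) ?u0// subrr subr0 {2}/amplitude ltxx wave0 mxE subr0.
have -> : T - u = T * e by rewrite /u; ring.
rewrite mulrA; apply=> r _; apply: le_trans (ler_normB _ _) _.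
by rewrite (_ : 2 = 1 + 1)// lerD// nscld_le1.
Qed.

End WaveSolution.

Theorem proposition5p3 (R : realType) (n k : nat)
    (hk : n.+1 = k.*2 \/ n.+1 = k.*2.+1)
    (w : 'I_n.+1 -> R) (w_ge0 : forall i, 0 <= w i)
    (cld_gathering : gathering_protocol (cld w))
    (s : bool) (j : nat) (hj : (1 <= j <= k)%N)
    (Z0 : conf R n) (Z0_V : Z0 \in Vspace n s j) (Z0_neq0 : Z0 != 0)
    (i : 'I_n.+1) :
  let c := - (Normc.normc (- 1 + lambda w j) / (- 1 + complex.Re (lambda w j))) in
  let t_gather := c * norm_robot i Z0 in
  [/\ gathers_at_time (nscld w) Z0 t_gather 0,
      0 < t_gather,
      (n.+1 <> j.*2 -> forall a0 b0 : R,
         Z0 = a0 *: basis1 n s j + b0 *: basis2 n s j ->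
         t_gather = c * norm2 (a0, b0)) &
      (n.+1 = j.*2 -> forall a0 : R,
         Z0 = a0 *: basis_half n s j ->
         t_gather = c * `|a0|)].
Proof.
move=> c t_gather; have [j0 jk] := andP hj.
have jn : (j.*2 <= n.+1)%N.
  by case: hk => ->; rewrite ?leqW ?leq_double.
have [c0 Z0E] := Vspace_wave s j Z0 Z0_V.
have c0_neq0 : c0 != 0.
  by apply: contra Z0_neq0 => /eqP c00; rewrite Z0E c00 wave0.
(* Conjugation changes neither the real part nor the modulus of mu, so both signs share one
   gathering time. *)
have Re_mu : complex.Re (-1 + lambda_s s w j) = -1 + complex.Re (lambda w j).
  by rewrite ReD /lambda_s; case: (s) => //; case: (lambda w j).
have norm_mu : nc (-1 + lambda_s s w j) = nc (-1 + lambda w j).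
  rewrite /lambda_s; case: (s) => //.
  by rewrite -[RHS]normc_conj rmorphD rmorphN rmorph1.
have Re_mu_lt0 : complex.Re (-1 + lambda_s s w j) < 0.
  by rewrite ReD /= addrC subr_lt0 (gathering_lambda_s s w j).
have tE : t_gather = gather_time w s j c0.
  by rewrite /t_gather /c /gather_time Z0E norm_robot_wave norm_mu Re_mu.
split.
- rewrite tE Z0E; apply: gathers_wave => //.
  exact: gathering_sum_weights.
- by rewrite tE; apply: gather_time_gt0.
- move=> _ a0 b0 Z0ab; rewrite /t_gather Z0ab wave_basis norm_robot_wave.
  (* For V_j^- the amplitude is b0 + i a0, with the coefficients swapped. *)
  by case: (s); rewrite /norm2 //= addrC.
- move=> nj a0 Z0a; rewrite /t_gather Z0a wave_basis_half// norm_robot_wave.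
  by case: (s); rewrite ?normc_real//= expr0n add0r sqrtr_sqr.
Qed.
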